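(* Let $\sum_{n=1}^\infty x_n$ be a convergent series of positive, non-increasing terms such that its achievement set $E=E(x_n)$ is a standard Cantorval. Then $\lambda(E)=\lambda(\mathrm{int}\,E)$, where $\lambda$ denotes Lebesgue measure on $\mathbb R$ and $\mathrm{int}\,E$ is the interior of $E$ in $\mathbb R$.
   Context: $\mathbb N=\{1,2,3,\dots\}$. For a convergent series $\sum x_n$ of positive terms, the achievement set is $E(x_n)=\{y\in\mathbb R:\ \exists A\subset\mathbb N,\ y=\sum_{n\in A}x_n\}$ (the empty sum is $0$). For $n\ge 0$ put $r_n=\sum_{i>n}x_i$ and let $E_n=\{\sum_{i\in A}x_i:\ A\subset\{n+1,n+2,\dots\}\}$ be the achievement set of the $n$-th remainder. For a closed set $A\subset\mathbb R$, the bounded components of $\mathbb R\setminus A$ are called $A$-gaps and the non-trivial (i.e. not one-point) components of $A$ are called $A$-intervals. A Cantorval is a non-empty compact set $A\subset\mathbb R$ having at least one $A$-gap, such that every endpoint of an $A$-gap is simultaneously the limit of a sequence of $A$-gaps and of a sequence of $A$-intervals. Let $\sum x_n$ be a convergent series of positive, non-increasing terms such that $E=E(x_n)$ is a Cantorval, and let $P_n$ denote a longest component of $E_n$, with length $|P_n|$. Then $E$ is called a standard Cantorval if $\limsup_{n\to\infty}\frac{|P_n|}{r_n}>0$. *)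

(* Defs.v *)
From mathcomp Require Import all_boot all_order all_algebra.
From mathcomp Require Import all_classical all_reals all_analysis.

Set Implicit Arguments.
Unset Strict Implicit.
Unset Printing Implicit Defensive.

Import Order.TTheory GRing.Theory Num.Theory.
Import numFieldNormedType.Exports.

Local Open Scope classical_set_scope.
Local Open Scope ring_scope.

(* Sequences are indexed from 0: [x i] is the term usually written x_{i+1}, so
   the terms of the n-th remainder, x_{n+1}, x_{n+2}, ..., are the [x i] with
   n <= i. *)

Definition subsum (R : realType) (x : nat -> R) (A : set nat) : R :=
  limn (fun m => \sum_(0 <= i < m | i \in A) x i).

Definition achievement_set (R : realType) (x : nat -> R) : set R :=
  [set y | exists A : set nat, y = subsum x A].

Definition remainder_achievement_set (R : realType) (x : nat -> R) (n : nat) :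
    set R :=
  [set y | exists2 A : set nat,
             A `<=` [set i | (n <= i)%N] & y = subsum x A].

Definition remainder (R : realType) (x : nat -> R) (n : nat) : R :=
  limn (fun m => \sum_(n <= i < m) x i).

Definition component (R : realType) (A C : set R) : Prop :=
  exists2 t : R, A t & C = connected_component A t.

Definition gap (R : realType) (A G : set R) : Prop :=
  component (~` A) G /\ bounded_set G.

Definition nontrivial_component (R : realType) (A I : set R) : Prop :=
  component A I /\ exists s t : R, [/\ I s, I t & s != t].

(* A gap of a closed set is a bounded nonempty open interval, whose endpoints
   are its infimum and its supremum. *)
Definition gap_endpoint (R : realType) (A : set R) (p : R) : Prop :=
  exists2 G : set R, gap A G & p = inf G \/ p = sup G.

(* Convergence of sets to a point: S n is eventually contained in each
   neighbourhood of p.  For nonempty bounded sets this is convergence to {p}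
   in the Hausdorff distance; a constant sequence of non-degenerate intervals
   does not converge to any point. *)
Definition sets_cvg_to (R : realType) (S : nat -> set R) (p : R) : Prop :=
  forall U : set R, nbhs p U -> \forall n \near \oo, S n `<=` U.

Definition cantorval (R : realType) (A : set R) : Prop :=
  [/\ A !=set0,
      compact A,
      exists G : set R, gap A G &
      forall p : R, gap_endpoint A p ->
        (exists2 G : nat -> set R,
           (forall n, gap A (G n)) & sets_cvg_to G p) /\
        (exists2 I : nat -> set R,
           (forall n, nontrivial_component A (I n)) & sets_cvg_to I p)].

(* The length of a bounded interval, degenerate intervals included. *)
Definition interval_length (R : realType) (I : set R) : R := sup I - inf I.

Definition longest_component (R : realType) (A P : set R) : Prop :=
  component A P /\
  forall Q : set R, component A Q -> interval_length Q <= interval_length P.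

(* The upper limit does not depend on the choice of the longest components,
   since any two longest components of a set have the same length.  It is
   taken in the extended reals, where it always exists. *)
Definition standard_cantorval (R : realType) (x : nat -> R) : Prop :=
  cantorval (achievement_set x) /\
  exists2 P : nat -> set R,
    (forall n, longest_component (remainder_achievement_set x n) (P n)) &
    (0 < limn_esup (fun n => (interval_length (P n) / remainder x n)%:E))%E.

(* Main.v *)
(** Let [c > 0] be such that [E_n] contains an interval of length greater than
    [c * r_n] for infinitely many [n].  A point [y] of [E] lies in a translate
    [f + E_n] contained in [E] and in [[f, f + r_n]], and this translate
    contains an open interval of length at least [c * r_n], necessarily disjoint
    from [E] minus its interior.  Since [r_n] tends to [0], this difference set
    has no point of Lebesgue density 1, hence it is a null set. *)

Require Import Defs.
From mathcomp Require Import all_boot all_order all_algebra.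
From mathcomp Require Import all_classical all_reals all_analysis.
From mathcomp Require Import measurable_realfun lra.
Import Order.TTheory GRing.Theory Num.Theory.
Import numFieldNormedType.Exports.

Local Open Scope classical_set_scope.
Local Open Scope ring_scope.

(** By the Lebesgue density theorem almost every point of [B] has density 1. A hole of relative size
    [c] at arbitrarily small scales prevents this; it need not be centred at [y], only contained in
    the ball. *)
Lemma porous_null (R : realType) (B : set R) (c : R) :
  measurable B -> 0 < c ->
  (forall y, B y -> forall e, 0 < e -> exists s t r,
    [/\ 0 < r < e, c * r < t - s, `]s, t[ `<=` ball y r
      & B `&` `]s, t[ = set0]) ->
  lebesgue_measure B = 0.
Proof.
move=> mB c0 porB; have [N [mN N0 subN]] := lebesgue_density mB.
apply: (subset_measure0 _ mN _ N0) => // y By; apply: subN => /= dens.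
(* A hole longer than [c * r] in a ball of length [2 * r] leaves [B] a proportion below
   [1 - c / 2]. *)
have /dens : nbhs (\1_B y)%:E [set z : \bar R | ((1 - c / 2)%:E < z)%E].
  apply: open_nbhs_nbhs; split; first exact: open_ereal_gt_ereal.
  by rewrite /= indicE mem_set// lte_fin ltrBlDr ltrDl divr_gt0.
case=> e /= e0 near_e.
have [s [t [r [/andP[r0 re] crts stball Bst]]]] := porB y By e e0.
have /= := near_e r; rewrite sub0r normrN gtr0_norm// => /(_ re r0).
have st : s < t by rewrite -subr_gt0 (lt_trans _ crts)// mulr_gt0.
have mball : measurable (ball y r).
  by apply: open_measurable; exact: ball_open.
have mBb : measurable (B `&` ball y r) by exact: measurableI.
(* The extended inverse is defined by cases; [r != 0] selects the real one. *)
rewrite /= lebesgue_measure_ball ?(ltW r0)// inver mulrn_eq0 /= gt_eqF//.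
have : (lebesgue_measure (B `&` ball y r) + lebesgue_measure `]s, t[
       <= (r *+ 2)%:E)%E.
  rewrite -(lebesgue_measure_ball y (ltW r0)) -measureU//; last first.
    by rewrite setIAC Bst set0I.
  apply: le_measure; rewrite ?inE//; first exact: measurableU.
  by move=> u [[]|/stball].
rewrite lebesgue_measure_itv /= lte_fin st -EFinD.
(* Finiteness turns the estimate into an inequality between reals. *)
have : (lebesgue_measure (B `&` ball y r) \is a fin_num)%E.
  rewrite ge0_fin_numE//.
  apply: (@le_lt_trans _ _ (lebesgue_measure (ball y r))).
    by apply: le_measure; rewrite ?inE//; exact: subIsetr.
  by rewrite lebesgue_measure_ball ?(ltW r0)// ltry.
move=> /fineK <-; move: (fine _) => b.
rewrite -EFinM -EFinD lee_fin lte_fin => bst.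
rewrite ltr_pdivlMr ?mulrn_wgt0// => ltb.
by lra.
Qed.

Section subsums.
Variables (R : realType) (x : nat -> R).
Hypotheses (x_gt0 : forall n, 0 < x n) (x_summable : cvgn (series x)).

Lemma is_cvg_subsum (A : set nat) :
  cvgn (fun m => \sum_(0 <= i < m | i \in A) x i).
Proof.
under eq_fun do rewrite big_mkcond.
apply: (@series_le_cvg R (fun i => if i \in A then x i else 0) x) => //= n.
- by case: ifP => // _; exact: ltW.
- exact: ltW.
- by case: ifP => // _; exact: ltW.
Qed.

Lemma subsum_le (A B : set nat) : A `<=` B -> subsum x A <= subsum x B.
Proof.
move=> AB; apply: ler_lim; [exact: is_cvg_subsum..|].
apply: nearW => m; rewrite big_mkcond [leRHS]big_mkcond /=.
apply: ler_sum => i _; have := ltW (x_gt0 i) => xi.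
case: ifPn => [iA|_]; last by case: ifP.
by rewrite mem_set//; apply: AB; exact: set_mem.
Qed.

Lemma subsum_set0 : subsum x set0 = 0.
Proof.
rewrite /subsum (_ : (fun m => _) = cst 0) ?lim_cst//.
by apply/funext => m; rewrite big_pred0// => i; rewrite in_set0.
Qed.

Lemma subsum_ge0 (A : set nat) : 0 <= subsum x A.
Proof. by rewrite -subsum_set0; apply: subsum_le; exact: sub0set. Qed.

Lemma subsumU (A B : set nat) : A `&` B = set0 ->
  subsum x (A `|` B) = subsum x A + subsum x B.
Proof.
move=> AB0; rewrite /subsum -limD; try exact: is_cvg_subsum.
congr (limn _); apply/funext => m.
rewrite fctE 3!(big_mkcond (fun i => i \in _)) -big_split /=.
apply: eq_bigr => i _; rewrite in_setU.
have [iA|_] := boolP (i \in A); last by rewrite add0r.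
rewrite ifF ?addr0//; apply/negbTE/negP => iB.
by have : (A `&` B) i := conj (set_mem iA) (set_mem iB); rewrite AB0.
Qed.

Lemma remainder_subsum n : remainder x n = subsum x [set i | (n <= i)%N].
Proof.
congr (limn _); apply/funext => m; rewrite (big_nat_widenl _ 0)//=.
by apply: eq_bigl => i; rewrite mem_setE.
Qed.

Lemma remainder_series n : remainder x n = limn (series x) - series x n.
Proof.
apply: cvg_lim => //; have : series x m - series x n @[m --> \oo]
    --> limn (series x) - series x n by apply: cvgB => //; exact: cvg_cst.
apply: cvg_trans; apply: near_eq_cvg; near=> m.
by rewrite sub_series_geq//; near: m; exact: nbhs_infty_ge.
Unshelve. all: by end_near. Qed.

Lemma remainder_gt0 n : 0 < remainder x n.
Proof.
rewrite remainder_series (lt_le_trans (x_gt0 n))// lerBrDr.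
rewrite addrC -seriesSr; apply: nondecreasing_cvgn_le x_summable _.
by apply/nondecreasing_seqP => m; rewrite seriesSr lerDl ltW.
Qed.

Lemma remainder_cvg0 : remainder x @ \oo --> 0.
Proof.
rewrite (funext remainder_series) -(subrr (limn (series x))).
by apply: cvgB => //; exact: cvg_cst.
Qed.

Lemma remainder_achievement_set_bounds n y :
  remainder_achievement_set x n y -> 0 <= y <= remainder x n.
Proof.
by move=> [A sA ->]; rewrite subsum_ge0 remainder_subsum subsum_le.
Qed.

(** Cut the index set of [y] at [n]: [f] is the sum over the indices below [n], and the remaining
    indices may be replaced by any others from [n] on. *)
Lemma achievement_set_translate n y : achievement_set x y ->
  exists f, [/\ f <= y <= f + remainder x n
    & forall z, remainder_achievement_set x n z -> achievement_set x (f + z)].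
Proof.
move=> [A ->]; pose A0 := A `&` [set i | (i < n)%N].
pose A1 := A `&` [set i | (n <= i)%N].
have disj B : B `<=` [set i | (n <= i)%N] -> A0 `&` B = set0.
  move=> sB; rewrite -subset0 => i [[_ /= ltin] /sB /=].
  by rewrite leqNgt ltin.
have sA1 : A1 `<=` [set i | (n <= i)%N] by move=> i [].
have -> : A = A0 `|` A1.
  apply/seteqP; split=> [i Ai|i [[]|[]]//].
  by have [|] := ltnP i n; [left|right].
exists (subsum x A0); rewrite subsumU ?disj//; split.
  by rewrite lerDl subsum_ge0 lerD2l remainder_subsum subsum_le.
by move=> z [B sB ->]; exists (A0 `|` B); rewrite subsumU ?disj.
Qed.

End subsums.

Lemma limn_esup_gt0 (R : realType) (u : nat -> R) :
  (0 < limn_esup (fun n => (u n)%:E))%E ->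
  exists2 c, 0 < c & forall n, exists2 m, (n <= m)%N & c < u m.
Proof.
set l := limn_esup _ => l0.
have [c c0 cl] : exists2 c : R, 0 < c & (c%:E < l)%E.
  (* The upper limit may be infinite, and then any positive [c] will do. *)
  case: l l0 => [l| |]//; last by exists 1; rewrite ?ltry.
  by rewrite lte_fin => l0; exists (l / 2); rewrite ?lte_fin; lra.
exists c => // n; apply: contrapT => no.
suff : (l <= c%:E)%E by rewrite leNgt cl.
(* The upper limit is an infimum of suprema over neighbourhoods of infinity; the tail from [n] on is
   one of them. *)
apply: ereal_inf_le; exists (ereal_sup ((EFin \o u) @` [set m | (n <= m)%N])).
  by exists [set m | (n <= m)%N] => //; exists n.
apply: ge_ereal_sup => _ [m /= nm <-]; rewrite lee_fin leNgt.
by apply/negP => cu; apply: no; exists m.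
Qed.

(** A connected set of reals is an interval, and a bounded interval has the open interval between
    its infimum and supremum as interior. For a one-point component this interval is empty. *)
Lemma component_open_itv (R : realType) (A C : set R) :
  has_lbound A -> has_ubound A -> component A C -> `]inf C, sup C[ `<=` A.
Proof.
move=> lA uA [t At ->]; set C0 := connected_component A t.
have C0A : C0 `<=` A by exact: connected_component_sub.
have /connected_intervalP iC : connected C0 by exact: component_connected.
apply: (subset_trans _ C0A).
apply: subset_trans (@interior_subset _ C0).
rewrite interval_bounded_interior//.
- by case: lA => a la; exists a => z /C0A/la.
- by case: uA => a la; exists a => z /C0A/la.
Qed.

Theorem theorem5 (R : realType) (x : nat -> R)
    (x_gt0 : forall n : nat, 0 < x n)
    (x_noninc : nonincreasing_seq x)
    (x_summable : cvgn (series x))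
    (E_standard : standard_cantorval x) :
  lebesgue_measure (achievement_set x) =
  lebesgue_measure (interior (achievement_set x)).
Proof.
have [[_ cE _ _] [P longP /limn_esup_gt0[c c0 cP]]] := E_standard.
set E := achievement_set x.
have mE : measurable E.
  by apply: closed_measurable; exact: compact_closed.
have mE0 : measurable (interior E) by apply: open_measurable; exact: open_interior.
have mD : measurable (E `\` interior E) by exact: measurableD.
rewrite -{1}(setDUK (@interior_subset _ E)) measureU//; last first.
  by rewrite setIC setDKI.
suff D0 : lebesgue_measure (E `\` interior E) = 0.
  by rewrite [X in (_ + X)%E]D0 adde0.
apply: (porous_null _ _ _ mD c0) => y [Ey _] e e0.
have /cvgrPdist_lt/(_ _ e0)[N _ small] := remainder_cvg0 R x x_summable.
(* One index [n >= N] serves both purposes: [r_n < e] and [c < |P_n| / r_n]. *)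
have [n /small/= rn_e cPn] := cP N.
have rn0 := remainder_gt0 R x x_gt0 x_summable n.
have [f [/andP[fy yf] fE]] := achievement_set_translate R x x_gt0 x_summable n y Ey.
have bnd := remainder_achievement_set_bounds R x x_gt0 x_summable.
have PE : `]inf (P n), sup (P n)[ `<=` remainder_achievement_set x n.
  apply: component_open_itv; last exact: (longP n).1.
    by exists 0 => z /bnd/andP[].
  by exists (remainder x n) => z /bnd/andP[].
have fPE : `]f + inf (P n), f + sup (P n)[ `<=` E.
  move=> z /=; rewrite in_itv /= => /andP[zl zr].
  by rewrite -(subrK f z) addrC; apply/fE/PE; rewrite /= in_itv /=; lra.
(* The hole is the translated interior of [P n], at scale [r_n]: both it and [y] lie in
   [[f, f + r_n]]. *)
exists (f + inf (P n)), (f + sup (P n)), (remainder x n); split.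
- by rewrite rn0; move: rn_e; rewrite sub0r normrN gtr0_norm.
- by move: cPn; rewrite ltr_pdivlMr// /interval_length; lra.
- move=> z; rewrite /= in_itv /= => /andP[zl zr].
  (* Averaging with an endpoint makes the inequalities [f < z < f + r_n] strict. *)
  have /PE/bnd/andP[L _] : (inf (P n) + (z - f)) / 2 \in `]inf (P n), sup (P n)[.
    by rewrite in_itv /=; lra.
  have /PE/bnd/andP[_ U] : (z - f + sup (P n)) / 2 \in `]inf (P n), sup (P n)[.
    by rewrite in_itv /=; lra.
  by rewrite /ball /= ltr_norml; lra.
(* The hole is open and contained in [E], hence in the interior of [E], which has been removed. *)
- rewrite -subset0 => z [[_ nEz] fz]; apply: nEz.
  by move: fPE; rewrite open_subsetE; [apply | exact: interval_open].
Qed.
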